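(* Let $G=(V,E)$ be a finite graph and $U\subseteq V$ a vertex subset of $G$. Then $$\sigma(G)=\sum_{\substack{W\subseteq U\\ W\text{ is independent}}}\sigma\bigl(G_{-U-N_G(W)}\bigr).$$
   Context: Graphs are finite and simple (undirected, no loops or multiple edges). A vertex set is independent if no two of its vertices are adjacent (the empty set is independent). $\sigma(G)$ denotes the number of independent vertex sets of $G$; the empty graph (no vertices) has $\sigma=1$. For $W\subseteq V$, $N_G(W)$ is the open neighborhood of $W$, i.e. the set of all vertices of $G$ adjacent to some vertex of $W$. For $X\subseteq V$, $G_{-X}$ is the graph obtained from $G$ by removing all vertices of $X$ and their incident edges; $G_{-U-N_G(W)}=G_{-(U\cup N_G(W))}$. *)

(* Defs.v *)
From mathcomp Require Import all_boot.

Set Implicit Arguments.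
Unset Strict Implicit.
Unset Printing Implicit Defensive.

Record sgraph := SGraph {
  vertex :> finType;
  adj : rel vertex;
  adj_sym : symmetric adj;
  adj_irrefl : irreflexive adj
}.

Definition independent (G : sgraph) (S : {set G}) : bool :=
  [forall x in S, forall y in S, ~~ adj x y].

Definition sigma (G : sgraph) : nat :=
  #|[set S : {set G} | independent S]|.

Definition open_nbhd (G : sgraph) (W : {set G}) : {set G} :=
  [set y | [exists x in W, adj x y]].

Section RemoveVertices.
Variables (G : sgraph) (X : {set G}).

(* The vertex type is the actual subtype of the vertices outside X, so that
   sigma counts only vertex sets of the smaller graph. *)
Definition remaining : finType := {x : G | x \notin X}.

Definition remaining_adj : rel remaining := fun x y => adj (val x) (val y).

Lemma remaining_adj_sym : symmetric remaining_adj.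
Proof. by move=> x y; apply: adj_sym. Qed.

Lemma remaining_adj_irrefl : irreflexive remaining_adj.
Proof. by move=> x; apply: adj_irrefl. Qed.

Definition remove_vertices : sgraph :=
  SGraph remaining_adj_sym remaining_adj_irrefl.

End RemoveVertices.

(* Main.v *)
Require Import Defs.
From mathcomp Require Import all_boot.

(** Sort the independent sets [S] of [G] by their trace [W = S :&: U] on [U];
    this trace is independent because [S] is.  For a fixed independent
    [W \subset U], the sets [S] with trace [W] are exactly the sets [W :|: T]
    where [T] is independent, avoids [U] (so that the trace is [W]) and avoids
    the neighbours of [W] (so that no edge joins [T] to [W]): see
    [card_independent_trace].  These [T] are the independent sets of the graph
    from which [U] and the neighbours of [W] have been removed: see
    [sigma_remove_vertices]. *)

Lemma independentP (G : sgraph) (S : {set G}) :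
  reflect {in S &, forall x y, ~~ adj x y} (independent S).
Proof.
apply: (iffP forall_inP) => [indS x y Sx Sy | indS x Sx].
  exact: (forall_inP (indS x Sx)).
by apply/forall_inP => y Sy; apply: indS.
Qed.

Lemma independentS (G : sgraph) (A B : {set G}) :
  A \subset B -> independent B -> independent A.
Proof.
move=> /subsetP sAB /independentP indB; apply/independentP => x y Ax Ay.
by apply: indB; apply: sAB.
Qed.

(** By symmetry of adjacency, avoiding the neighbours of [A] rules out the
    edges between [A] and [B] in both directions. *)
Lemma independentU (G : sgraph) (A B : {set G}) :
  independent (A :|: B) =
    [&& independent A, independent B & [disjoint B & open_nbhd A]].
Proof.
apply/idP/and3P => [indAB | [/independentP indA /independentP indB dBA]].
  split; [exact: independentS (subsetUl A B) indAB |
          exact: independentS (subsetUr A B) indAB |].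
  rewrite disjoint_subset; apply/subsetP => y By; rewrite !inE.
  apply/exists_inP => -[x Ax xy]; move/independentP: indAB => /(_ x y).
  by rewrite !inE Ax By orbT xy => /(_ isT isT).
have noAB x y : x \in A -> y \in B -> ~~ adj x y.
  move=> Ax By; apply/negP => xy; have /negP[] := negbT (disjointFr dBA By).
  by rewrite inE; apply/exists_inP; exists x.
apply/independentP => x y /setUP[Ax | Bx] /setUP[Ay | By].
- exact: indA.
- exact: noAB.
- by rewrite adj_sym; apply: noAB.
- exact: indB.
Qed.

(** Taking images under the inclusion of the remaining vertices identifies
    the independent sets of the smaller graph with sets of vertices of [G],
    which can then be joined to other sets of vertices of [G]. *)
Lemma sigma_remove_vertices (G : sgraph) (X : {set G}) :
  sigma (remove_vertices X) =
    #|[set T : {set G} | independent T && [disjoint T & X]]|.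
Proof.
pose incl (T : {set remove_vertices X}) : {set G} := [set val x | x in T].
have incl_inj : injective incl by apply/imset_inj/val_inj.
rewrite /sigma -(card_imset _ incl_inj); apply: eq_card => T; rewrite inE.
apply/imsetP/andP => [[T' + ->] | [/independentP indT dTX]].
  rewrite inE => /independentP indT'; split.
    by apply/independentP => _ _ /imsetP[x Tx ->] /imsetP[y Ty ->]; apply: indT'.
  rewrite disjoint_subset; apply/subsetP => _ /imsetP[x _ ->].
  exact: (valP x).
exists [set x : remove_vertices X | val x \in T].
  by rewrite inE; apply/independentP => x y; rewrite !inE; apply: indT.
apply/setP => x; apply/idP/imsetP => [Tx | [x' + ->]]; last by rewrite inE.
have Xx : x \notin X by rewrite (disjointFr dTX Tx).
by exists (Sub x Xx : remove_vertices X); rewrite ?inE.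
Qed.

Lemma disjointUr (T : finType) (A B C : {set T}) :
  [disjoint A & B :|: C] = [disjoint A & B] && [disjoint A & C].
Proof. by rewrite -!setI_eq0 setIUr setU_eq0. Qed.

(** The correspondence is [T |-> W :|: T], with inverse [S |-> S :\: U]. *)
Lemma card_independent_trace (G : sgraph) (U W : {set G}) :
  W \subset U -> independent W ->
  #|[set S : {set G} | independent S && (S :&: U == W)]| =
    #|[set T : {set G} | independent T && [disjoint T & U :|: open_nbhd W]]|.
Proof.
move=> sWU indW.
have trD (T : {set G}) : [disjoint T & U] -> (W :|: T) :\: U = T.
  by move=> dTU; rewrite setDUl (setDidPl dTU) (eqP (_ : W :\: U == set0)) ?set0U ?setD_eq0.
rewrite -[RHS](card_in_imset (f := fun T => W :|: T)); last first.
  move=> T1 T2; rewrite !inE !disjointUr.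
  move=> /and3P[_ dT1 _] /and3P[_ dT2 _] eqWT.
  by rewrite -(trD T1 dT1) eqWT trD.
apply: eq_card => S; rewrite inE.
apply/andP/imsetP => [[indS /eqP traceS] | [T + ->]].
  have defS : W :|: S :\: U = S by rewrite -traceS setID.
  have dDU : [disjoint S :\: U & U] by rewrite -setI_eq0 setIDAC setDIl setDv setI0.
  exists (S :\: U) => //; move: indS; rewrite -{1}defS independentU.
  by rewrite inE disjointUr dDU => /and3P[_ -> ->].
rewrite inE disjointUr => /and3P[indT dTU dTN].
rewrite independentU indW indT dTN; split=> //.
by rewrite setIUl (setIidPl sWU) (disjoint_setI0 dTU) setU0.
Qed.

Theorem theorem2 (G : sgraph) (U : {set G}) :
  sigma G =
    \sum_(W : {set G} | (W \subset U) && independent W)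
       sigma (remove_vertices (U :|: open_nbhd W)).
Proof.
rewrite {1}/sigma -sum1_card.
rewrite (partition_big (fun S => S :&: U)
           (fun W => (W \subset U) && independent W)) /=; last first.
  move=> S; rewrite inE => indS; rewrite subsetIr.
  exact: independentS (subsetIl S U) indS.
apply: eq_bigr => W /andP[sWU indW].
rewrite sigma_remove_vertices -card_independent_trace // -sum1_card.
by apply: eq_bigl => S; rewrite !inE.
Qed.
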